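(* Every $(2K_2,K_4,H_4)$-free graph is recolorable. That is, if $G$ contains no induced subgraph isomorphic to $2K_2$, $K_4$ or $H_4$, then $\mathcal{R}_\ell(G)$ is connected for every integer $\ell>\chi(G)$.
   Context: All graphs are finite and simple. $2K_2$ is the disjoint union of two edges (four vertices), and $K_4$ is the complete graph on four vertices. The wheel $W_5$ is obtained from a $5$-cycle by adding one vertex adjacent to all five vertices of the cycle; $H_4$ is the graph obtained from $W_5$ by deleting one spoke edge (so $H_4$ is a $5$-cycle together with one additional vertex adjacent to exactly four of the vertices of the cycle). A graph is $(F_1,\dots,F_k)$-free if it contains no induced subgraph isomorphic to any $F_i$. For an integer $\ell$, a proper $\ell$-coloring of $G$ assigns to each vertex one of $\ell$ fixed colors so that adjacent vertices receive distinct colors (not all colors need be used); $\chi(G)$ is the chromatic number. The reconfiguration graph $\mathcal{R}_\ell(G)$ has as its vertices the proper $\ell$-colorings of $G$, two colorings being adjacent if they differ on exactly one vertex of $G$. A graph $G$ is recolorable if $\mathcal{R}_\ell(G)$ is connected for every $\ell>\chi(G)$. *)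

(* Defs.v *)
From mathcomp Require Import all_boot.

Set Implicit Arguments.
Unset Strict Implicit.
Unset Printing Implicit Defensive.

Record sgraph := SGraph {
  vertex :> finType;
  adj : rel vertex;
  adj_sym : symmetric adj;
  adj_irr : irreflexive adj }.

(* The simple graph on {0, ..., n-1} with the listed unordered pairs as edges;
   the order inside a pair is irrelevant and loops are discarded. *)
Section EdgeList.
Variables (n : nat) (s : seq (nat * nat)).

Definition edges_rel : rel 'I_n := fun i j =>
  (i != j) && (((i : nat, j : nat) \in s) || ((j : nat, i : nat) \in s)).

Lemma edges_rel_sym : symmetric edges_rel.
Proof. by move=> i j; rewrite /edges_rel eq_sym orbC. Qed.

Lemma edges_rel_irr : irreflexive edges_rel.
Proof. by move=> i; rewrite /edges_rel eqxx. Qed.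

Definition edges_graph : sgraph := SGraph edges_rel_sym edges_rel_irr.
End EdgeList.

Section DeleteEdge.
Variables (G : sgraph) (u v : G).

Definition del_edge_rel : rel G := fun x y =>
  [&& adj x y, ~~ ((x == u) && (y == v)) & ~~ ((x == v) && (y == u))].

Lemma del_edge_rel_sym : symmetric del_edge_rel.
Proof.
move=> x y; rewrite /del_edge_rel adj_sym; congr (_ && _).
by do 4!case: (_ == _).
Qed.

Lemma del_edge_rel_irr : irreflexive del_edge_rel.
Proof. by move=> x; rewrite /del_edge_rel adj_irr. Qed.

Definition del_edge : sgraph := SGraph del_edge_rel_sym del_edge_rel_irr.
End DeleteEdge.

Section Complete.
Variable n : nat.

Definition complete_rel : rel 'I_n := fun i j => i != j.

Lemma complete_rel_sym : symmetric complete_rel.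
Proof. by move=> i j; rewrite /complete_rel eq_sym. Qed.

Lemma complete_rel_irr : irreflexive complete_rel.
Proof. by move=> i; rewrite /complete_rel eqxx. Qed.

Definition complete_graph : sgraph := SGraph complete_rel_sym complete_rel_irr.
End Complete.

Definition two_K2 : sgraph := edges_graph 4 [:: (0, 1); (2, 3)].

Definition K4 : sgraph := complete_graph 4.

(* The rim is 0-1-2-3-4-0 and the hub is 5. *)
Definition W5 : sgraph :=
  edges_graph 6 ([:: (0, 1); (1, 2); (2, 3); (3, 4); (4, 0)]
              ++ [:: (5, 0); (5, 1); (5, 2); (5, 3); (5, 4)]).

Definition H4 : sgraph :=
  @del_edge W5 (@Ordinal 6 5 isT) (@Ordinal 6 4 isT).

Definition has_induced (H G : sgraph) : Prop :=
  exists2 f : H -> G, injective f & forall x y, adj (f x) (f y) = adj x y.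

Definition induced_free (H G : sgraph) : Prop := ~ has_induced H G.

Definition proper (G : sgraph) (l : nat) (c : {ffun G -> 'I_l}) : bool :=
  [forall x, forall y, adj x y ==> (c x != c y)].

Definition colorable (G : sgraph) (l : nat) : bool :=
  [exists c : {ffun G -> 'I_l}, proper c].

Lemma colorable_ex (G : sgraph) : exists l, colorable G l.
Proof.
exists #|G|; apply/existsP; exists [ffun x => enum_rank x].
apply/forallP=> x; apply/forallP=> y; apply/implyP=> xy.
rewrite !ffunE (inj_eq enum_rank_inj); apply: contraTneq xy => ->.
by rewrite adj_irr.
Qed.

Definition chi (G : sgraph) : nat := ex_minn (colorable_ex G).

Section Reconfiguration.
Variables (G : sgraph) (l : nat).

Definition pcoloring : finType := {c : {ffun G -> 'I_l} | proper c}.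

Definition recolor_rel : rel pcoloring := fun c d =>
  #|[set x | val c x != val d x]| == 1.

Lemma recolor_rel_sym : symmetric recolor_rel.
Proof.
move=> c d; rewrite /recolor_rel; congr (#|pred_of_set _| == 1).
by apply/setP=> x; rewrite !inE eq_sym.
Qed.

Lemma recolor_rel_irr : irreflexive recolor_rel.
Proof.
move=> c; rewrite /recolor_rel (_ : [set x | _] = set0) ?cards0 //.
by apply/setP=> x; rewrite !inE eqxx.
Qed.

Definition reconf_graph : sgraph := SGraph recolor_rel_sym recolor_rel_irr.
End Reconfiguration.

Definition connected (G : sgraph) : Prop := forall x y : G, connect (@adj G) x y.

Definition recolorable (G : sgraph) : Prop :=
  forall l : nat, chi G < l -> connected (reconf_graph G l).

(* Main.v *)
Require Import Defs.
From mathcomp Require Import all_boot.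

Set Implicit Arguments.
Unset Strict Implicit.
Unset Printing Implicit Defensive.

(* Call a vertex set S irreducible if it contains no two vertices u <> v with
   N(u) \cap S \subset N(v).  If such u, v exist, u can copy every move of v, so u
   can be deleted.  If S is irreducible, removing any maximal independent set T
   from S lowers the chromatic number (T_lowers_chi), and this gives mixing with
   one extra color: a color class of a coloring extends to a maximal independent
   set T by single moves, S \ T is mixing with the remaining colors by induction,
   and since S \ T has a spare color one can make T' \ T monochromatic, hence move
   from T to any other maximal independent set T'.

   For the claim on irreducible S there are three cases.  If S contains W5, it is
   an induced subgraph of the complement of the icosahedron.  If S contains no W5,
   then every maximal independent set T meets every induced C5 and every induced
   complement of C7, so that S \ T is 3-colorable: after deleting nested vertices
   it becomes a clique or a prism.  If S is 3-colorable, it is a clique, C5, a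
   prism, or the circular clique K_{9/3}.  Each of these facts is a
   finite search, run inside the logic: starting from a few vertices with known
   adjacencies, repeatedly pick a vertex that must exist (it separates two vertices
   with nested neighborhoods, or belongs to T and sees a given vertex outside T)
   and try all its possible adjacencies to the vertices found so far. *)

(** * Search procedure *)

(* A finite graph is encoded by the adjacencies of each vertex to the later ones. *)
Fixpoint pat (A : Type) (E : A -> A -> bool) (o : seq A) : seq (seq bool) :=
  if o is a :: o' then [seq E a b | b <- o'] :: pat E o' else [::].

(* Here and below, nested conditionals replace || because vm_compute is strict. *)
Fixpoint any_masked (f : seq bool -> bool) (m : seq bool) (A : seq (seq bool)) :=
  match m, A with
  | b :: m', r :: A' =>
      if b then if f r then true else any_masked f m' A' else any_masked f m' A'
  | _, _ => false
  end.

Definition upd_mask (r : seq bool) (b : bool) (m : seq bool) :=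
  [seq p.1 && (b == p.2) | p <- zip m r].

(* [A] is a full adjacency matrix; [ms] gives, for each vertex of the pattern [p],
   the mask of the vertices of [A] compatible with the choices made so far. *)
Fixpoint emb (A : seq (seq bool)) (p ms : seq (seq bool)) : bool :=
  match p, ms with
  | pr :: p', m :: ms' =>
      any_masked (fun r => emb A p' [seq upd_mask r q.1 q.2 | q <- zip pr ms']) m A
  | _, _ => true
  end.

(* Only embeddings that send the first vertex of [p] to the first (most recent)
   vertex of [A] are tried. *)
Definition emb_head (A p : seq (seq bool)) : bool :=
  match A, p with
  | r :: _, pr :: p' => emb A p' [seq [seq b == x | x <- r] | b <- pr]
  | _, _ => false
  end.

Fixpoint lazy_has (f : nat -> bool) (s : seq nat) :=
  if s is c :: s' then if f c then true else lazy_has f s' else false.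

Definition or_mask (r f : seq bool) := [seq p.1 || p.2 | p <- zip r f].

(* [nth [::] fs c] marks the remaining vertices at which color [c] is forbidden. *)
Fixpoint rows_colorable (k : nat) (p : seq (seq bool)) (fs : seq (seq bool)) : bool :=
  if p is r :: p' then
    lazy_has (fun c => if head false (nth [::] fs c) then false else
       rows_colorable k p' [seq (if i == c then or_mask r (behead (nth [::] fs i))
                       else behead (nth [::] fs i)) | i <- iota 0 k]) (iota 0 k)
  else true.

Fixpoint upper_rows (n : nat) (A : seq (seq bool)) : seq (seq bool) :=
  match n, A with
  | m.+1, r :: A' => behead r :: upper_rows m [seq behead x | x <- A']
  | _, _ => [::]
  end.

Definition mat_colorable k A :=
  rows_colorable k (upper_rows (size A) A) (nseq k (nseq (size A) false)).

Definition add_row (r : seq bool) (A : seq (seq bool)) :=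
  (false :: r) :: [seq p.1 :: p.2 | p <- zip r A].

Definition submat (J : seq bool) (A : seq (seq bool)) := mask J [seq mask J r | r <- A].

Fixpoint bitseqs n : seq (seq bool) :=
  if n is m.+1 then [seq b :: s | b <- [:: true; false], s <- bitseqs m] else [:: [::]].

Definition mat_maxind (J : seq bool) A :=
  all (fun r => ~~ has id r) (submat J A) &&
  all (fun p => p.1 || has id (mask J p.2)) (zip J A).

Definition leaf_lowers_chi m A :=
  mat_colorable m A &&
  all (fun k => if mat_colorable k A then
     all (fun J => if mat_maxind J A
                   then mat_colorable k.-1 (submat [seq ~~ b | b <- J] A) else true)
      (bitseqs (size A)) else true) (iota 1 m).

(* An obligation lists the positions that a vertex known to exist must see and must
   not see. *)
Definition meets (q : seq nat * seq nat) (r : seq bool) :=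
  all (nth false r) q.1 && ~~ has (nth false r) q.2.

Definition dominated A (p : nat * nat) :=
  let ru := nth [::] A p.1 in
  [&& p.1 != p.2, ~~ nth false ru p.2 &
    all (fun b => b.1 ==> b.2) (zip ru (nth [::] A p.2))].

Definition obl_irreducible (A : seq (seq bool)) : seq (seq nat * seq nat) :=
  let n := size A in
  [seq ([:: p.1], [:: p.2]) |
     p <- [seq (u, v) | u <- iota 0 n, v <- iota 0 n] & dominated A p].

(* The [k] oldest vertices lie outside the maximal independent set, all others in it. *)
Definition obl_maxind (k : nat) (A : seq (seq bool)) : seq (seq nat * seq nat) :=
  let m := size A - k in
  [seq ([:: u], iota 0 m) | u <- iota m k & ~~ has id (take m (nth [::] A u))].

(** Branching on the obligation with the fewest candidate rows keeps the search tree small. *)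
Definition min_size (c : seq (seq bool)) cs :=
  foldl (fun c d : seq (seq bool) => if size d < size c then d else c) c cs.

(* A search state is the adjacency matrix [A] of the vertices found so far, most
   recent first, and the list [ex] of all rows that a vertex of the graph may have. *)
Section Run.
Variables (bad : seq (seq bool) -> bool) (leaf : seq (seq bool) -> bool)
  (obl : seq (seq bool) -> seq (seq nat * seq nat)).

Definition grow A (ex : seq (seq bool)) :=
  [seq r <- [seq b :: r | b <- [:: true; false], r <- ex] | ~~ bad (add_row r A)].

(** When no obligation is open, either the vertices found are the whole set, which [leaf] has to
    settle, or a further vertex with any of the remaining rows exists. *)
Fixpoint run fuel A ex :=
  if fuel is m.+1 then
    let child r := let A' := add_row r A in run m A' (grow A' ex) in
    if [seq filter (meets q) ex | q <- obl A] is c :: cs then all child (min_size c cs)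
    else leaf A && all child ex
  else false.

Fixpoint init_state (p : seq (seq bool)) : seq (seq bool) * seq (seq bool) :=
  if p is r :: p' then
    let s := init_state p' in let A := add_row r s.1 in (A, grow A s.2)
  else ([::], [:: [::]]).
End Run.

Definition edge_rel (s : seq (nat * nat)) (i j : nat) := ((i, j) \in s) || ((j, i) \in s).

Definition E_2K2 := edge_rel [:: (0, 1); (2, 3)].
Definition E_K4 (i j : nat) := i != j.
Definition E_H4 := edge_rel [:: (0, 1); (1, 2); (2, 3); (3, 4); (4, 0);
  (5, 0); (5, 1); (5, 2); (5, 3)].

(* The circular clique K_{p/q} on 0, ..., p-1: C5 is K_{5/2}, the prism is K_{6/2} and
   the complement of C7 is K_{7/2}. *)
Definition circ p q (i j : nat) := q <= maxn i j - minn i j <= p - q.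

(* The complement of the icosahedron; the first six vertices induce W5, with hub 5. *)
Definition coico (i j : nat) := (i != j) && ~~ edge_rel
  [:: (0, 1); (1, 2); (2, 3); (3, 4); (4, 0);
      (5, 6); (5, 7); (5, 8); (5, 9); (5, 10);
      (6, 9); (9, 7); (7, 8); (8, 10); (10, 6);
      (6, 0); (6, 1); (9, 1); (9, 2); (7, 2); (7, 3); (8, 3); (8, 4); (10, 4); (10, 0);
      (11, 0); (11, 1); (11, 2); (11, 3); (11, 4)] i j.

Fixpoint has_pat A ps :=
  if ps is p :: ps' then if emb_head A p then true else has_pat A ps' else false.

Definition search bad leaf obl fuel p :=
  let s := init_state bad p in run bad leaf obl fuel s.1 s.2.

(** * Soundness of the search *)

Lemma zip_map2 (A B C : Type) (f : A -> B) (g : A -> C) s :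
  zip (map f s) (map g s) = [seq (f x, g x) | x <- s].
Proof. by elim: s => //= x s ->. Qed.

Section Soundness.
Variable G : sgraph.
Implicit Types (vs us xs : seq G) (S T : {set G}) (x y w : G).

Definition row vs w := [seq adj w y | y <- vs].
Definition mat vs := [seq row vs x | x <- vs].

Lemma add_rowE vs w : add_row (row vs w) (mat vs) = mat (w :: vs).
Proof.
rewrite /add_row /mat /row /= adj_irr zip_map2 -map_comp.
by congr (_ :: _); apply: eq_map => x /=; rewrite adj_sym.
Qed.

Lemma any_masked_sound f (P : pred G) (g : G -> seq bool) vs :
  any_masked f (map P vs) (map g vs) -> exists2 x, x \in vs & P x && f (g x).
Proof.
elim: vs => //= x vs IH; case Px: (P x); last first.
  by case/IH=> y yvs Py; exists y; rewrite ?inE ?yvs ?orbT.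
case fg: (f (g x)); last first.
  by case/IH=> y yvs Py; exists y; rewrite ?inE ?yvs ?orbT.
by move=> _; exists x; rewrite ?mem_head // Px fg.
Qed.

(** Each mask is read as a predicate on vertices, so that the induction can follow the constraints
    on the pattern vertices not yet placed. *)
Lemma emb_sound (E : nat -> nat -> bool) o (Ps : seq (pred G)) vs :
  size Ps = size o ->
  emb (mat vs) (pat E o) [seq map P vs | P <- Ps] ->
  exists xs, [/\ size xs = size o, all (mem vs) xs,
    all2 (fun (P : pred G) x => P x) Ps xs & pat (@adj G) xs = pat E o].
Proof.
elim: o Ps => [|a o IH] [|P Ps] //= => [_ _|[sz]]; first by exists [::].
case/any_masked_sound => x xvs /andP[Px].
(* [Qs] adds to each predicate the adjacency to the chosen image [x] that the pattern prescribes. *)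
pose Qs := [seq (fun y => q.2 y && (q.1 == adj x y)) | q <- zip [seq E a b | b <- o] Ps].
rewrite (_ : [seq _ | _ <- zip _ _] = [seq map Q vs | Q <- Qs]); last first.
  rewrite /Qs -map_comp; elim: (o) (Ps) => [|b o' IHo] [|P' Ps'] //=.
  by rewrite IHo /upd_mask /row zip_map2 -map_comp.
case/IH; first by rewrite /Qs size_map size_zip size_map sz minnn.
move=> xs [szx xsvs Qxs pxs]; exists (x :: xs); split=> /=; rewrite ?szx ?xvs //.
- rewrite Px /=; move: Qxs; rewrite /Qs.
  elim: (o) (Ps) (xs) sz szx => [|b o' IHo] [|P' Ps'] [|y ys] //= [] sz [] szx.
  by case/andP=> /andP[-> _] /(IHo _ _ sz szx).
- rewrite pxs; congr (_ :: _); move: Qxs; rewrite /Qs.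
  elim: (o) (Ps) (xs) sz szx => [|b o' IHo] [|P' Ps'] [|y ys] //= [] sz [] szx.
  by case/andP=> /andP[_ /eqP ->] /(IHo _ _ sz szx) ->.
Qed.

Lemma emb_head_sound (E : nat -> nat -> bool) a o x vs :
  emb_head (mat (x :: vs)) (pat E (a :: o)) ->
  exists xs, [/\ size xs = size (a :: o), all (mem (x :: vs)) xs
    & pat (@adj G) xs = pat E (a :: o)].
Proof.
pose Qs := [seq (fun y => b == adj x y) | b <- [seq E a b | b <- o]].
have -> : emb_head (mat (x :: vs)) (pat E (a :: o)) =
    emb (mat (x :: vs)) (pat E o) [seq map Q (x :: vs) | Q <- Qs].
  congr (emb _ _ _); rewrite /Qs -!map_comp; apply: eq_map => b.
  by rewrite /comp /row -[LHS]map_comp.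
case/(@emb_sound E o Qs (x :: vs)); first by rewrite /Qs !size_map.
move=> xs [sz xsv Qxs pxs]; exists (x :: xs); split=> /=.
- by rewrite sz.
- by rewrite mem_head.
rewrite pxs; congr (_ :: _); move: Qxs; rewrite /Qs.
elim: (o) (xs) sz => [|b o' IHo] [|y ys] //= [] sz.
by case/andP=> /eqP -> /(IHo _ sz) ->.
Qed.

Lemma pat_nth (A : Type) (E : A -> A -> bool) (F : G -> G -> bool) a x0 o xs i j :
  pat E o = pat F xs -> size o = size xs -> i < j < size o ->
  F (nth x0 xs i) (nth x0 xs j) = E (nth a o i) (nth a o j).
Proof.
elim: o xs i j => [|b o IH] [|x xs] [|i] [|j] //=; rewrite ?andbF //.
  move=> [] h _ [] sz; rewrite ltnS => jo; move: (congr1 (nth false ^~ j) h).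
  by rewrite /= (nth_map a) // (nth_map x0) -?sz.
by move=> [] _ /IH h [] /h; rewrite !ltnS; apply.
Qed.

Definition contains S k (E : nat -> nat -> bool) : Prop :=
  exists xs, [/\ size xs = k, all (mem S) xs & pat (@adj G) xs = pat E (iota 0 k)].

(** The same pattern is listed in several orders, one for each choice of root in [emb_head]; this
    brings them back to the standard order. *)
Lemma contains_reorder S E o xs k : symmetric E -> perm_eq o (iota 0 k) ->
  size xs = size o -> all (mem S) xs -> pat (@adj G) xs = pat E o -> contains S k E.
Proof.
move=> Esym po sz xsS pxs.
have so : size o = k by rewrite (perm_size po) size_iota.
case: k po so => [|k] po so; first by exists [::].
have x0 : G by case: (xs) sz so => [|//] <-.
have uo : uniq o by rewrite (perm_uniq po) iota_uniq.
pose f i := nth x0 xs (index i o).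
have fE i j : i \in o -> j \in o -> i != j -> adj (f i) (f j) = E i j.
  move=> io jo; rewrite -index_mem in io; rewrite -index_mem in jo => nij.
  have [ilt|jlt|] := ltngtP (index i o) (index j o).
  - rewrite (@pat_nth _ E (@adj G) 0 x0 o) ?ilt ?jo //.
    by rewrite !nth_index // -index_mem.
  - rewrite adj_sym (@pat_nth _ E (@adj G) 0 x0 o) ?jlt ?io //.
    by rewrite !nth_index 1?Esym // -index_mem.
  move/(congr1 (nth 0 o)); rewrite !nth_index -?index_mem // => eij.
  by rewrite eij eqxx in nij.
exists (map f (iota 0 k.+1)); split; first by rewrite size_map size_iota.
  apply/allP => _ /mapP[i ik ->]; apply: (allP xsS); apply: mem_nth.
  by rewrite sz index_mem (perm_mem po).
have : {subset iota 0 k.+1 <= o} by move=> i; rewrite (perm_mem po).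
elim: (iota 0 k.+1) (iota_uniq 0 k.+1) => //= i s IH /andP[nis us] sub.
rewrite IH // => [|j js]; last by rewrite sub // inE js orbT.
congr (_ :: _); rewrite -map_comp; apply/eq_in_map => j js /=.
apply: fE; rewrite ?sub ?inE ?eqxx ?js ?orbT //.
by apply: contraNneq nis => ->.
Qed.

End Soundness.

Lemma map_to_const (A B : Type) (b : B) (s : seq A) :
  [seq b | _ <- s] = nseq (size s) b.
Proof. by elim: s => //= a s ->. Qed.

(** * Correctness of the coloring tests *)

Section Coloring.
Variable G : sgraph.
Implicit Types (vs us xs : seq G) (S T : {set G}) (x y w : G).

Definition colorable_on (A : {pred G}) k := exists f : G -> nat,
  {in A, forall x, f x < k} /\ {in A &, forall x y, adj x y -> f x != f y}.

Definition maxind S T := [/\ T \subset S, {in T &, forall x y, ~~ adj x y}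
  & {in S, forall x, x \notin T -> exists2 y, y \in T & adj x y}].

Definition T_lowers_chi S := forall k T, colorable_on S k -> maxind S T ->
  colorable_on (S :\: T) k.-1.

Lemma colorable_onW (A B : {pred G}) k l : {subset A <= B} -> k <= l ->
  colorable_on B k -> colorable_on A l.
Proof.
move=> sAB kl [f [fk fp]]; exists f; split=> [x /sAB xB|x y /sAB xB /sAB yB].
  exact: leq_trans (fk _ xB) kl.
exact: fp.
Qed.

Lemma upper_rowsE vs : upper_rows (size vs) (mat vs) = pat (@adj G) vs.
Proof.
elim: vs => //= x vs <-; congr (_ :: upper_rows _ _).
by rewrite -map_comp; apply: eq_map.
Qed.

Lemma lazy_hasE f s : lazy_has f s = has f s.
Proof. by elim: s => //= c s ->; case: (f c). Qed.

Definition forb k (F : nat -> pred G) vs := [seq map (F c) vs | c <- iota 0 k].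

Definition forb_add (F : nat -> pred G) c x : nat -> pred G :=
  fun i y => if i == c then adj x y || F i y else F i y.

Lemma rows_colorable_cons k F x vs :
  rows_colorable k (pat (@adj G) (x :: vs)) (forb k F (x :: vs)) =
  has (fun c => ~~ F c x && rows_colorable k (pat (@adj G) vs) (forb k (forb_add F c x) vs)) (iota 0 k).
Proof.
rewrite [LHS]/= lazy_hasE; apply/eq_in_has => c; rewrite mem_iota /= => ck.
have fE i : i < k -> nth [::] (forb k F (x :: vs)) i = F i x :: map (F i) vs.
  by move=> ik; rewrite (nth_map 0) ?size_iota // nth_iota.
rewrite fE //=.
case: (F c x) => //=; congr (rows_colorable _ _ _); apply/eq_in_map => i.
rewrite mem_iota => /= ik; rewrite fE //= /forb_add; case: eqP => // _.
by rewrite /or_mask zip_map2 -map_comp.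
Qed.

(** Forbidden colors record the neighbors already colored, which is the generality that induction on
    the vertex list requires. *)
Definition list_coloring k (F : nat -> pred G) vs := exists f : G -> nat,
  {in vs, forall x, f x < k /\ ~~ F (f x) x} /\
  {in vs &, forall x y, adj x y -> f x != f y}.

Lemma rows_colorable_complete k F vs : list_coloring k F vs ->
  rows_colorable k (pat (@adj G) vs) (forb k F vs).
Proof.
elim: vs F => [//|x vs IH] F [f [fk fp]]; rewrite rows_colorable_cons; apply/hasP.
have [fx Fx] := fk x (mem_head _ _).
exists (f x); first by rewrite mem_iota.
rewrite Fx; apply/IH; exists f; split=> [y yvs|y z yvs zvs]; last first.
  by apply: fp; rewrite inE ?yvs ?zvs orbT.
have yxvs : y \in x :: vs by rewrite inE yvs orbT.
have [fy Fy] := fk y yxvs; split=> //; rewrite /forb_add; case: eqP => // e.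
rewrite negb_or Fy andbT; apply/negP => /(fp _ _ (mem_head _ _) yxvs).
by rewrite e eqxx.
Qed.

Lemma rows_colorable_sound k F vs : uniq vs -> rows_colorable k (pat (@adj G) vs) (forb k F vs) ->
  list_coloring k F vs.
Proof.
elim: vs F => [|x vs IH] F; first by exists (fun=> 0).
case/andP=> xvs uvs; rewrite rows_colorable_cons => /hasP[c].
rewrite mem_iota /= => ck /andP[Fc /(IH _ uvs)[f [fk fp]]].
exists (fun y => if y == x then c else f y); split=> [y|y z].
  rewrite inE; case: eqP => [-> //|_ /= /fk[fy]].
  by rewrite /forb_add; case: eqP => // _; rewrite negb_or => /andP[].
rewrite !inE; have [->|nyx] := eqVneq y x; have [->|nzx] := eqVneq z x => //=.
- by rewrite adj_irr.
- move=> _ /fk[_]; rewrite /forb_add eq_sym; case: eqP => // _.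
  by rewrite negb_or => /andP[/negPf ->].
- move=> /fk[_ h] _; rewrite adj_sym; move: h; rewrite /forb_add; case: eqP => // _.
  by rewrite negb_or => /andP[/negPf ->].
- exact: fp.
Qed.

Lemma mat_colorableE k vs : mat_colorable k (mat vs) = rows_colorable k (pat (@adj G) vs) (forb k (fun _ _ => false) vs).
Proof.
rewrite /mat_colorable size_map upper_rowsE /forb (@eq_map _ _ _ (fun=> nseq (size vs) false)) => [|i].
  by rewrite map_to_const size_iota.
exact: map_to_const.
Qed.

Lemma mat_colorable_complete k vs : colorable_on (mem vs) k -> mat_colorable k (mat vs).
Proof.
move=> [f [fk fp]]; rewrite mat_colorableE; apply: rows_colorable_complete.
by exists f; split=> // x xvs; split=> //; apply: fk.
Qed.

Lemma mat_colorable_sound k vs : uniq vs -> mat_colorable k (mat vs) -> colorable_on (mem vs) k.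
Proof.
rewrite mat_colorableE => uvs /(rows_colorable_sound uvs)[f [fk fp]]; exists f; split=> // x xvs.
by case: (fk x xvs).
Qed.

Lemma submatE J vs : submat J (mat vs) = mat (mask J vs).
Proof.
rewrite /submat /mat -map_comp map_mask; congr (mask _ _).
by apply: eq_map => x /=; rewrite /row map_mask.
Qed.

Lemma mem_bitseqs J : J \in bitseqs (size J).
Proof.
elim: J => //= b J IH; rewrite cats0 mem_cat.
by case: b; rewrite map_f // orbT.
Qed.

Lemma leaf_lowers_chi_sound m S vs : uniq vs -> S =i vs -> leaf_lowers_chi m (mat vs) ->
  colorable_on S m /\ T_lowers_chi S.
Proof.
move=> uvs Svs /andP[/(mat_colorable_sound uvs) cm /allP chk].
have Sm : colorable_on S m.
  by apply: colorable_onW cm => // x; rewrite Svs.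
split=> // k T cSk [sTS indT maxT].
have sub : {subset S :\: T <= S} by move=> x /setDP[].
have [k0|k0] := posnP k; first by apply: colorable_onW cSk => //; rewrite k0.
(* For larger [k], a coloring of [S] with [m] colors already fits into [k.-1] colors. *)
have [mk|km] := ltnP m k.
  by apply: colorable_onW Sm => //; rewrite -ltnS prednK.
have := chk k; rewrite mem_iota k0 addnC addn1 ltnS km => /(_ isT).
rewrite mat_colorable_complete; last by apply: colorable_onW cSk => // x; rewrite Svs.
pose J := [seq x \in T | x <- vs].
move/allP/(_ J); rewrite size_map -(size_map (mem T) vs) mem_bitseqs => /(_ isT).
have mJ : mask J vs = [seq x <- vs | x \in T] by rewrite filter_mask.
have -> : mat_maxind J (mat vs).
  rewrite /mat_maxind submatE mJ; apply/andP; split.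
    apply/allP => _ /mapP[x + ->]; rewrite mem_filter => /andP[xT _].
    apply/hasPn => _ /mapP[y + ->]; rewrite mem_filter => /andP[yT _].
    exact: indT.
  rewrite zip_map2; apply/allP => _ /mapP[x xvs ->] /=; case: (boolP (x \in T)) => //= xT.
  have [|y yT xy] := maxT x _ xT; first by rewrite Svs.
  rewrite /row -map_mask mJ; apply/hasP; exists true => //; rewrite -xy.
  by apply: map_f; rewrite mem_filter yT -Svs (subsetP sTS).
rewrite submatE.
have -> : mask [seq ~~ b | b <- J] vs = [seq x <- vs | x \notin T].
  by rewrite filter_mask -map_comp.
move/(mat_colorable_sound (filter_uniq _ uvs)); apply: colorable_onW => // x.
by case/setDP=> xS xT; rewrite mem_filter xT -Svs.
Qed.
End Coloring.

Lemma mem_min_size c cs : min_size c cs \in c :: cs.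
Proof.
rewrite /min_size; elim: cs c => [|d cs IH] c /=; first exact: mem_head.
case: ifP => _; have := IH (if size d < size c then d else c).
  move: (IH d); rewrite !inE => /orP[->|->]; rewrite ?orbT //.
by move: (IH c); rewrite !inE => /orP[->|->]; rewrite ?orbT.
Qed.

(** * Soundness of the branching *)

Section RunSound.
Variables (G : sgraph) (S : {set G}) (Goal : Prop).
Variables (bad leaf : seq (seq bool) -> bool)
  (obl : seq (seq bool) -> seq (seq nat * seq nat)) (Inv : seq G -> Prop).
Hypothesis bad_goal : forall us : seq G, all (mem S) us -> bad (mat us) -> Goal.
Hypothesis Inv_sub : forall vs, Inv vs -> all (mem S) vs.
Hypothesis obl_inv : forall vs q, Inv vs -> q \in obl (mat vs) ->
  exists w, [/\ w \in S, meets q (row vs w) & Inv (w :: vs)].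
Hypothesis leaf_inv : forall vs, Inv vs -> leaf (mat vs) ->
  Goal \/ exists2 w, w \in S & Inv (w :: vs).

(** If the row of an actual vertex is filtered out, [S] contains a bad configuration and [Goal]
    follows. *)
Lemma grow_sound vs ex w0 : all (mem S) vs -> w0 \in S ->
  {in S, forall w, row vs w \in ex} ->
  Goal \/ {in S, forall w, row (w0 :: vs) w \in grow bad (mat (w0 :: vs)) ex}.
Proof.
move=> vsS w0S rex.
case: (boolP [exists w in S, bad (mat [:: w, w0 & vs])]).
  case/exists_inP=> w wS /bad_goal h; left; apply: h.
  by rewrite /= wS w0S.
move/exists_inPn=> nb; right=> w wS; rewrite mem_filter add_rowE nb //=.
rewrite cats0 mem_cat; have := rex w wS.
by case: (adj w w0) => rw; rewrite map_f ?orbT.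
Qed.

(** One branch always follows the actual graph, because the rows of its vertices stay in [ex]. With
    an arbitrary [Goal], a bad configuration may be a contradiction or a case settled earlier. *)
Lemma run_sound fuel vs ex : Inv vs -> {in S, forall w, row vs w \in ex} ->
  run bad leaf obl fuel (mat vs) ex -> Goal.
Proof.
elim: fuel vs ex => //= fuel IH vs ex Ivs rex.
have child w c : w \in S -> Inv (w :: vs) -> row vs w \in c ->
    all (fun r => run bad leaf obl fuel (add_row r (mat vs))
      (grow bad (add_row r (mat vs)) ex)) c -> Goal.
  move=> wS Iw wc /allP/(_ _ wc); rewrite add_rowE.
  by case: (grow_sound (Inv_sub Ivs) wS rex) => // h; apply: IH.
case E: [seq _ | _ <- _] => [|c cs].
  case/andP=> /(leaf_inv Ivs)[//|[w wS Iw]]; apply: child Iw _ => //; exact: rex.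
have := mem_min_size c cs; rewrite -E => /mapP[q /(obl_inv Ivs)[w [wS qw Iw]] ->].
by apply: child Iw _ => //; rewrite mem_filter qw rex.
Qed.

Lemma init_state_sound xs : all (mem S) xs -> Goal \/
  let s := init_state bad (pat (@adj G) xs) in
  s.1 = mat xs /\ {in S, forall w, row xs w \in s.2}.
Proof.
elim: xs => [|x xs IH] /=; first by right.
case/andP=> xS xsS; case: (IH xsS) => [|[e1 e2]]; first by left.
rewrite e1 add_rowE; case: (grow_sound xsS xS e2) => [|h]; first by left.
by right.
Qed.

Lemma search_sound fuel xs : Inv xs -> search bad leaf obl fuel (pat (@adj G) xs) -> Goal.
Proof.
move=> Ixs; case: (init_state_sound (Inv_sub Ixs)) => //=; rewrite /search.
case=> -> h; exact: run_sound.
Qed.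
End RunSound.

(** * The two kinds of search: irreducible sets and maximal independent sets *)

Section Modes.
Variables (G : sgraph) (S : {set G}) (Goal : Prop) (bad : seq (seq bool) -> bool).
Hypothesis bad_goal : forall us : seq G, all (mem S) us -> bad (mat us) -> Goal.

Definition irreducible := {in S &, forall u v, u != v ->
  exists w, [/\ w \in S, adj u w & ~~ adj v w]}.

Lemma nth_mat x0 (vs : seq G) i : i < size vs -> nth [::] (mat vs) i = row vs (nth x0 vs i).
Proof. by move=> lti; rewrite (nth_map x0). Qed.

Lemma search_irreducible (leaf : seq (seq bool) -> bool) fuel k E : irreducible ->
  (forall vs : seq G, uniq vs -> S =i vs -> leaf (mat vs) -> Goal) ->
  uniq (init_state bad (pat E (iota 0 k))).1 ->
  search bad leaf obl_irreducible fuel (pat E (iota 0 k)) ->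
  contains S k E -> Goal.
Proof.
move=> irr leafG urows gr [xs [szxs xsS e]]; rewrite -e in urows gr.
pose Inv (vs : seq G) := uniq vs && all (mem S) vs.
have [//|[e1 _]] := init_state_sound bad_goal xsS.
rewrite /= e1 in urows.
apply: (@search_sound G S Goal bad leaf _ Inv) gr => //.
- by move=> vs /andP[].
- move=> vs q /andP[uvs vsS] /mapP[[u v] + ->].
  rewrite mem_filter /dominated /= => /andP[/and3P[nuv nadj sub]].
  case/allpairsP=> -[u' v'] /= [+ + [eu ev]]; rewrite -{u'}eu -{v'}ev.
  rewrite !mem_iota !add0n /= size_map => ltu ltv.
  have x0 : G by case: (vs) ltu => [|x].
  rewrite !(nth_mat x0) // (nth_map x0) // in nadj sub.
  set x := nth x0 vs u in nadj sub; set y := nth x0 vs v in nadj sub.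
  have xS : x \in S by apply: (allP vsS); apply: mem_nth.
  have yS : y \in S by apply: (allP vsS); apply: mem_nth.
  have nxy : x != y by rewrite nth_uniq.
  have [w [wS xw yw]] := irr x y xS yS nxy.
  exists w; split=> //.
    by rewrite /meets /= !(nth_map x0) // !(adj_sym w) xw (negPf yw).
  (* The separating vertex is new: among the vertices found so far, every neighbor of [x] is a
     neighbor of [y]. *)
  rewrite /Inv /= wS uvs vsS !andbT; apply/negP=> wvs.
  move: sub; rewrite zip_map2 all_map => /allP/(_ w wvs) /=.
  by rewrite xw (negPf yw).
- move=> vs /andP[uvs vsS] lf.
  case: (boolP [exists w in S, w \notin vs]) => [/exists_inP[w wS wvs]|/exists_inPn h].
    by right; exists w => //; rewrite /Inv /= wvs uvs wS.
  left; apply: leafG lf => // x; apply/idP/idP; last by move/(allP vsS).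
  by move/h; rewrite negbK.
(* Distinct rows force the starting vertices to be distinct. *)
- by rewrite /Inv xsS andbT; apply: (@map_uniq _ _ (row xs)).
Qed.

(** No leaf is accepted, so each branch has to end at an obligation that no allowed row meets. *)
Lemma search_maxind (T : {set G}) fuel k E : 
  maxind S T ->
  search bad (fun=> false) (obl_maxind k) fuel (pat E (iota 0 k)) ->
  contains (S :\: T) k E -> Goal.
Proof.
move=> [TS indT maxT] gr [xs [szxs xsS e]]; rewrite -e in gr.
pose Inv (vs : seq G) := exists2 ts, all (mem T) ts & vs = ts ++ xs.
have xsS' : all (mem S) xs by apply/allP => x /(allP xsS) /setDP[].
apply: (@search_sound G S Goal bad _ _ Inv) gr => //.
- move=> _ [ts tsT ->]; rewrite all_cat xsS' andbT.
  by apply/allP => x /(allP tsT); apply: (subsetP TS).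
- move=> _ q [ts tsT ->] /mapP[u + ->].
  rewrite mem_filter !mem_iota size_map size_cat szxs addnK => /andP[nt /andP[mu uk]].
  have x0 : G by case: (xs) szxs uk mu => [<-|x //]; rewrite addn0 ltnNge => /negPf ->.
  rewrite (nth_mat x0) ?size_cat ?szxs // nth_cat ltnNge mu /= in nt.
  set x := nth x0 xs _ in nt.
  have xxs : x \in xs by apply: mem_nth; rewrite szxs ltn_subLR.
  have /setDP[xS xT] : x \in S :\: T by apply: (allP xsS).
  have [y yT xy] := maxT x xS xT.
  exists y; split; first exact: (subsetP TS).
    rewrite /meets /= (nth_map x0) ?size_cat ?szxs // nth_cat ltnNge mu /= -/x adj_sym xy /=.
    apply/hasPn => i; rewrite mem_iota add0n /= => it.
    rewrite (nth_map x0) ?size_cat ?(leq_trans it) ?leq_addr // nth_cat it.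
    by apply: indT => //; apply: (allP tsT); apply: mem_nth.
  by exists (y :: ts) => //=; rewrite yT.
- by exists [::].
Qed.
End Modes.

(** * Recoloring *)

Section Recoloring.
Variable G : sgraph.
Implicit Types (S T : {set G}) (P : seq nat) (f g h : G -> nat) (u v w x y : G).

Definition proper_on S P f :=
  {in S, forall x, f x \in P} /\ {in S &, forall x y, adj x y -> f x != f y}.

Definition recolor f v c : G -> nat := fun x => if x == v then c else f x.

(** Colorings are total functions compared on [S] only, so one function serves for all subsets. Only
    the colorings reached after a step are required to be proper, whence the extra premise of
    [reach_sym]. *)
Inductive reach S P : (G -> nat) -> (G -> nat) -> Prop :=
| reach_eq f g : {in S, f =1 g} -> reach S P f g
| reach_step f g v c : v \in S -> proper_on S P (recolor f v c) ->
    reach S P (recolor f v c) g -> reach S P f g.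

(** Palettes are arbitrary lists, so that the color of a frozen independent set can be withdrawn. *)
Definition mixing S l := forall P f g, uniq P -> size P = l ->
  proper_on S P f -> proper_on S P g -> reach S P f g.

Lemma proper_on_eq S P f g : {in S, f =1 g} -> proper_on S P f -> proper_on S P g.
Proof.
move=> fg [fP fp]; split=> [x xS|x y xS yS xy]; rewrite -!fg //; first exact: fP.
exact: fp.
Qed.

Lemma reach_eql S P f f' g : {in S, f =1 f'} -> reach S P f' g -> reach S P f g.
Proof.
move=> ff' R; elim: R f ff' => {f' g} [f' g e|f' g v c vS pr _ IH] f ff'.
  by apply: reach_eq => x xS; rewrite ff' // e.
have e : {in S, recolor f v c =1 recolor f' v c}.
  by move=> x xS; rewrite /recolor ff'.
apply: reach_step vS _ (IH _ e); apply: proper_on_eq pr => x xS.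
by rewrite e.
Qed.

Lemma reach_trans S P f g h : reach S P f g -> reach S P g h -> reach S P f h.
Proof.
move=> R; elim: R h => {f g} [f g e|f g v c vS pr _ IH] h Rgh.
  exact: reach_eql Rgh.
exact: reach_step (IH _ Rgh).
Qed.

Lemma reach_sym S P f g : proper_on S P f -> reach S P f g -> reach S P g f.
Proof.
move=> + R; elim: R => {f g} [f g e _|f g v c vS pr _ IH pf].
  by apply: reach_eq => x xS; rewrite e.
apply: reach_trans (IH pr) _.
have e : {in S, f =1 recolor (recolor f v c) v (f v)}.
  by move=> x _; rewrite /recolor; case: eqP => [->|].
apply: reach_step vS (proper_on_eq e pf) _.
by apply: reach_eq => x xS; rewrite -e.
Qed.

Lemma mixing_comparable S u v l : u \in S -> v \in S -> u != v ->
  {in S, forall w, adj u w -> adj v w} ->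
  mixing (S :\ u) l -> mixing S l.
Proof.
move=> uS vS nuv sub mix P f g uP sP pf pg.
have nvu : (v == u) = false by rewrite eq_sym (negPf nuv).
have uv : ~~ adj u v by apply/negP => /(sub v vS); rewrite adj_irr.
have vSu : v \in S :\ u by rewrite !inE nvu.
have pr h : proper_on (S :\ u) P h -> proper_on S P (recolor h u (h v)).
  move=> [hP hp]; split=> [x xS|x y xS yS].
    by rewrite /recolor; case: eqP => [_|/eqP nxu]; apply: hP => //; rewrite !inE nxu.
  rewrite /recolor; have [->|nx] := eqVneq x u; have [->|ny] := eqVneq y u.
  - by rewrite adj_irr.
  - by move/(sub y yS); apply: hp => //; rewrite !inE ny.
  - by rewrite adj_sym => /(sub x xS); rewrite adj_sym; apply: hp => //; rewrite !inE nx.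
  - by apply: hp; rewrite !inE ?nx ?ny.
have rs h : proper_on S P h -> proper_on (S :\ u) P h.
  move=> [hP hp]; split=> [x /setD1P[_ /hP]//|x y /setD1P[_ xS] /setD1P[_ yS]].
  exact: hp.
(* [f] and [g] are each one move away from a coloring in which [u] has the color of [v]; the path on
   [S :\ u] is mirrored between these. *)
suff R h h' : proper_on (S :\ u) P h -> reach (S :\ u) P h h' ->
    reach S P (recolor h u (h v)) (recolor h' u (h' v)).
  have Rf h : proper_on S P h -> reach S P h (recolor h u (h v)).
    by move=> ph; apply: reach_step uS (pr _ (rs _ ph)) _; apply: reach_eq.
  apply: reach_trans (Rf _ pf) _.
  apply: reach_trans (R _ _ (rs _ pf) (mix P f g uP sP (rs _ pf) (rs _ pg))) _.
  exact: reach_sym (Rf _ pg).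
move=> + R; elim: R => {h h'} [h h' e _|h h' w c wS ph _ IH ph0].
  apply: reach_eq => x xS; rewrite /recolor e //; case: eqP => // /eqP nx.
  by rewrite e // !inE nx.
have /setD1P[nwu wS'] := wS.
have {IH} := IH ph.
case: (eqVneq w v) => [ewv|nwv]; last first.
  have ev : recolor h w c v = h v by rewrite /recolor eq_sym (negPf nwv).
  rewrite ev.
  have e : {in S, recolor (recolor h w c) u (h v) =1 recolor (recolor h u (h v)) w c}.
    move=> x _; rewrite /recolor; case: (eqVneq x u) => // ->.
    by rewrite eq_sym (negPf nwu).
  move=> R; apply: (@reach_step _ _ _ _ w c wS').
    by apply: proper_on_eq e _; rewrite -ev; apply: pr.
  by apply: reach_eql R => x xS; rewrite e.
subst w; have cv : recolor h v c v = c by rewrite /recolor eqxx.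
rewrite cv => R.
(* When [v] changes color, [v] moves first and [u] follows; in between, [u] keeps the old color of
   [v], which is proper because [u] and [v] are nonadjacent. *)
have p1 : proper_on S P (recolor (recolor h u (h v)) v c).
  have [hP hp] := pr _ ph0; have [cP cp] := ph.
  have nb y : y \in S -> y != u -> adj v y -> c != h y.
    move=> yS yu vy; have := cp v y vSu; rewrite cv !inE yu yS => /(_ isT vy).
    by rewrite /recolor; case: (eqVneq y v) vy => // ->; rewrite adj_irr.
  split=> [x xS|x y xS yS].
    rewrite {1}/recolor; case: eqP => _; last exact: hP.
    by rewrite -cv; apply: cP.
  rewrite {1 3}/recolor; have [->|nx] := eqVneq x v; have [->|ny] := eqVneq y v.
  - by rewrite adj_irr.
  - rewrite /recolor; have [->|yu] := eqVneq y u; last exact: nb.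
    by rewrite adj_sym (negPf uv).
  - rewrite adj_sym eq_sym /recolor; have [->|xu] := eqVneq x u; last exact: nb.
    by rewrite adj_sym (negPf uv).
  - exact: hp.
apply: (@reach_step _ _ _ _ v c vS p1).
have e : {in S, recolor (recolor h v c) u c =1 recolor (recolor (recolor h u (h v)) v c) u c}.
  by move=> x _; rewrite /recolor; case: (x == u); case: (x == v).
apply: (@reach_step _ _ _ _ u c uS).
  by apply: proper_on_eq e _; rewrite -{2}cv; apply: pr.
by apply: reach_eql R => x xS; rewrite e.
Qed.

Definition paint (s : {pred G}) c f : G -> nat := fun x => if x \in s then c else f x.

(** A vertex of [T] has no neighbor of color [c], since that class lies in the independent set [T];
    hence [T] can be painted one vertex at a time. *)
Lemma paint_proper S P T (s : {pred G}) c f : c \in P -> proper_on S P f ->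
  {in T &, forall x y, ~~ adj x y} -> {in S, forall x, f x = c -> x \in T} ->
  {subset s <= T} -> proper_on S P (paint s c f).
Proof.
move=> cP [fP fp] indT clT sT; split=> [x xS|x y xS yS].
  by rewrite /paint; case: ifP => // _; apply: fP.
rewrite /paint; case: ifP => xs; case: ifP => ys.
- by rewrite (negPf (indT _ _ (sT _ xs) (sT _ ys))).
- apply: contraL => /eqP/esym yc; apply: indT (sT _ xs) _; exact: clT.
- apply: contraL => /eqP xc; apply: indT (sT _ ys); exact: clT.
- exact: fp.
Qed.

Lemma reach_paint S P T c f : c \in P -> proper_on S P f -> T \subset S ->
  {in T &, forall x y, ~~ adj x y} -> {in S, forall x, f x = c -> x \in T} ->
  reach S P f (paint (mem T) c f).
Proof.
move=> cP pf TS indT clT.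
suff R (s : seq G) : {subset s <= T} -> reach S P f (paint (mem s) c f).
  apply: reach_trans (R (enum T) _) _ => [x|]; first by rewrite mem_enum.
  by apply: reach_eq => x _; rewrite /paint /= mem_enum.
elim: s => [_|x s IH sT]; first by apply: reach_eq.
have sT' : {subset s <= T} by move=> y ys; apply: sT; rewrite inE ys orbT.
apply: reach_trans (IH sT') _.
have e : {in S, paint (mem (x :: s)) c f =1 recolor (paint (mem s) c f) x c}.
  by move=> y _; rewrite /paint /recolor /= inE; case: eqP.
apply: (@reach_step _ _ _ _ x c).
- by apply: (subsetP TS); apply: sT; rewrite mem_head.
- apply: proper_on_eq e _; exact: paint_proper cP pf indT clT sT.
- by apply: reach_eq => y yS; rewrite e.
Qed.

Lemma paint_lift S P T c h : uniq P -> c \in P -> {in T &, forall x y, ~~ adj x y} ->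
  proper_on (S :\: T) (rem c P) h -> proper_on S P (paint (mem T) c h).
Proof.
move=> uP cP indT [hP hp]; have nc x : x \in S -> x \notin T -> h x != c.
  move=> xS xT; have := hP x; rewrite inE xS xT => /(_ isT).
  by rewrite mem_rem_uniq // inE => /andP[].
split=> [x xS|x y xS yS]; rewrite /paint.
  by case: ifP => // /negbT xT; apply: (@mem_rem _ c); apply: hP; rewrite inE xT.
case: ifP => [xT|/negbT xT]; case: ifP => [yT|/negbT yT].
- by rewrite (negPf (indT _ _ xT yT)).
- by rewrite eq_sym nc.
- by rewrite nc.
- by apply: hp; rewrite inE ?xT ?yT.
Qed.

Lemma reach_lift S P T c f g : uniq P -> c \in P ->
  {in T &, forall x y, ~~ adj x y} -> reach (S :\: T) (rem c P) f g ->
  reach S P (paint (mem T) c f) (paint (mem T) c g).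
Proof.
move=> uP cP indT; elim=> {f g} [f g e|f g v d vST pr _ IH].
  apply: reach_eq => x xS; rewrite /paint; case: ifP => // /negbT xT.
  by apply: e; rewrite inE xT.
have /setDP[vS vT] := vST.
have e : {in S, paint (mem T) c (recolor f v d) =1 recolor (paint (mem T) c f) v d}.
  move=> x _; rewrite /paint /recolor; case: ifP => // xT.
  by case: eqP xT => // ->; rewrite (negPf vT).
apply: (reach_step vS _ (reach_eql _ IH)); last by move=> x xS; rewrite e.
by apply: proper_on_eq e _; apply: paint_lift.
Qed.

Lemma colorable_palette S k P : colorable_on S k -> uniq P -> k <= size P ->
  exists f, proper_on S P f.
Proof.
move=> [f [fk fp]] uP kP; have lt x : x \in S -> f x < size P.
  by move=> xS; apply: leq_trans (fk x xS) kP.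
exists (fun x => nth 0 P (f x)); split=> [x xS|x y xS yS xy]; first exact: mem_nth (lt x xS).
by rewrite nth_uniq ?lt //; apply: fp.
Qed.

Lemma mixing_step S k :
  (forall P f, uniq P -> size P = k.+2 -> proper_on S P f ->
    exists c T, [/\ c \in P, T \subset S, {in T &, forall x y, ~~ adj x y},
      {in S, forall x, f x = c -> x \in T} & colorable_on (S :\: T) k]) ->
  (forall T, colorable_on (S :\: T) k -> mixing (S :\: T) k.+1) ->
  mixing S k.+2.
Proof.
move=> cls mixT P f g uP sP pf pg.
have sPc c : c \in P -> uniq (rem c P) /\ size (rem c P) = k.+1.
  by move=> cP; rewrite rem_uniq // size_rem // sP.
pose ok T := [/\ T \subset S, {in T &, forall x y, ~~ adj x y} & colorable_on (S :\: T) k].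
have restr h c T : proper_on S P h -> c \in P -> {in S, forall x, h x = c -> x \in T} ->
    proper_on (S :\: T) (rem c P) h.
  move=> [hP hp] cP clT; split=> [x /setDP[xS xT]|x y /setDP[xS _] /setDP[yS _]]; last exact: hp.
  by rewrite mem_rem_uniq // inE hP // andbT; apply: contra xT => /eqP; apply: clT.
have same c T h h' : c \in P -> ok T ->
    proper_on (S :\: T) (rem c P) h -> proper_on (S :\: T) (rem c P) h' ->
    reach S P (paint (mem T) c h) (paint (mem T) c h').
  move=> cP [_ indT cT] ph ph'; apply: reach_lift => //.
  by have [uc sc] := sPc c cP; apply: mixT.
have to h c T : proper_on S P h -> c \in P -> ok T ->
    {in S, forall x, h x = c -> x \in T} -> 
    forall h', proper_on (S :\: T) (rem c P) h' -> reach S P h (paint (mem T) c h').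
  move=> ph cP okT clT h' ph'; have [TS indT _] := okT.
  apply: reach_trans (reach_paint cP ph TS indT clT) _.
  by apply: same => //; apply: restr.
(* Passage from [T] frozen in color [c] to [T'] frozen in another color [c']. *)
have switch c T c' T' : c \in P -> c' \in P -> c != c' -> ok T -> ok T' ->
    forall h h', proper_on (S :\: T) (rem c P) h -> proper_on (S :\: T') (rem c' P) h' ->
    reach S P (paint (mem T) c h) (paint (mem T') c' h').
  move=> cP c'P ncc okT okT' h h' ph ph'.
  have [TS indT cT] := okT; have [T'S indT' cT'] := okT'.
  have c'Pc : c' \in rem c P by rewrite mem_rem_uniq // inE eq_sym ncc.
  have [uc sc] := sPc c cP.
  (* [S :\: T] needs only [k] colors, so [c'] can be spared besides [c] and then given to
     [T' :\: T]. *)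
  have [q [qP qp]] : exists q, proper_on (S :\: T) (rem c' (rem c P)) q.
    by apply: colorable_palette cT _ _; rewrite ?rem_uniq // size_rem // sc.
  have qc' x : x \in S :\: T -> q x != c'.
    by move/qP; rewrite mem_rem_uniq // inE => /andP[].
  pose r := paint (mem T') c' q.
  have pr : proper_on (S :\: T) (rem c P) r.
    split=> [x xST|x y xST yST]; rewrite /r /paint.
      by case: ifP => // _; apply: mem_rem (qP x xST).
    case: ifP => xT; case: ifP => yT.
    - by rewrite (negPf (indT' _ _ xT yT)).
    - by rewrite eq_sym qc'.
    - by rewrite qc'.
    - exact: qp.
  apply: reach_trans (same _ _ _ _ cP okT ph pr) _.
  (* Color [c'] now occurs only inside [T'], as [to] demands. *)
  apply: to => // [|x xS]; first exact: paint_lift.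
  rewrite /paint; case: ifP => [_ /eqP|/negbT xT]; first by rewrite (negPf ncc).
  rewrite /r /paint; case: ifP => // _ /eqP; rewrite (negPf (qc' _ _)) //.
  by rewrite inE xT.
have [c [T [cP TS indT clT cT]]] := cls P f uP sP pf.
have [c' [T' [c'P T'S indT' clT' cT']]] := cls P g uP sP pg.
have okT : ok T by []. have okT' : ok T' by [].
have pgT' : proper_on (S :\: T') (rem c' P) g by apply: restr.
have pfT : proper_on (S :\: T) (rem c P) f by apply: restr.
apply: (@reach_trans _ _ _ (paint (mem T') c' g)); last first.
  apply: reach_sym; first exact: pg.
  exact: reach_paint.
apply: reach_trans (to _ _ _ pf cP okT clT f pfT) _.
have [ecc|ncc] := eqVneq c c'; last exact: switch.
(* [switch] demands distinct colors; if they coincide, [T] is first given another color [d]. *)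
have [d dP ncd] : exists2 d, d \in P & c != d.
  have [uc sc] := sPc c cP; case: (rem c P) uc sc (mem_rem_uniq c uP) => // d s _ _ m.
  by exists d; have := m d; rewrite mem_head inE => /esym/andP[dc dP]; rewrite // eq_sym.
have [q pq] : exists q, proper_on (S :\: T) (rem d P) q.
  have [ud sd] := sPc d dP; apply: colorable_palette cT ud _; rewrite sd //.
apply: reach_trans (switch c T d T cP dP ncd okT okT f q pfT pq) _.
by apply: switch => //; rewrite -ecc eq_sym.
Qed.

End Recoloring.

(** * Graphs without 2K_2, K_4 and H_4 *)

Section Patterns.
Variable G : sgraph.
Implicit Types (vs us xs : seq G) (S T : {set G}).

Lemma has_pat_cat A ps qs : has_pat A (ps ++ qs) = has_pat A ps || has_pat A qs.
Proof. by elim: ps => //= p ps ->; case: emb_head. Qed.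

Lemma has_pat_contains S E (os : seq (seq nat)) us : symmetric E ->
  all (fun o => perm_eq o (iota 0 (size o))) os -> all (mem S) us ->
  has_pat (mat us) [seq pat E o | o <- os] ->
  exists2 o, o \in os & contains S (size o) E.
Proof.
move=> Esym + usS; elim: os => //= o os IH /andP[po /IH{}IH].
case: ifP => [em _|_ /IH[o' o'os c]]; last by exists o'; rewrite // inE o'os orbT.
exists o; first exact: mem_head.
case: o us usS em po {IH} => [|a o] [|x us] // usS.
case/emb_head_sound=> xs [sz xsu pxs] po.
apply: contains_reorder po sz _ pxs => //.
by apply/allP => y /(allP xsu) /(allP usS).
Qed.

Lemma has_pat1 S E o us : symmetric E -> all (mem S) us ->
  has_pat (mat us) [:: pat E o] -> perm_eq o (iota 0 (size o)) ->
  contains S (size o) E.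
Proof.
move=> Esym usS hp po; case: (@has_pat_contains S E [:: o] us) => //= [|o'].
  by rewrite po.
by rewrite inE => /eqP->.
Qed.

(** Containment is decidable, so the later case distinctions on it are constructive. *)
Lemma containsP S k E :
  reflect (contains S k E) [exists t : k.-tuple G, all (mem S) t && (pat (@adj G) t == pat E (iota 0 k))].
Proof.
apply: (iffP existsP) => [[t /andP[tS /eqP e]]|[xs [sz xsS e]]].
  by exists t; rewrite size_tuple.
have szb : size xs == k by apply/eqP.
by exists (Tuple szb); rewrite xsS /= e eqxx.
Qed.

Lemma contains_sub S T k E : S \subset T -> contains S k E -> contains T k E.
Proof.
move=> ST [xs [sz xsS e]]; exists xs; split=> //.
by apply/allP => x /(allP xsS); apply: (subsetP ST).
Qed.

Lemma contains_not_colorable S k l E :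
  ~~ mat_colorable l (init_state (fun=> false) (pat E (iota 0 k))).1 ->
  contains S k E -> ~ colorable_on S l.
Proof.
move=> nc [xs [sz xsS e]] cS; move: nc; rewrite -e.
(* With no bad matrix, [init_state] just rebuilds the adjacency matrix of [xs]. *)
have [//|[-> _]] := @init_state_sound G S False (fun=> false) (fun _ _ => notF) xs xsS.
case/negP; apply: mat_colorable_complete; apply: colorable_onW cS => // x.
exact: (allP xsS).
Qed.

Lemma contains_induced S n (r : rel 'I_n) (rs : symmetric r) (ri : irreflexive r)
    (E : rel nat) :
  symmetric E -> (forall x y, r x y = E x y) ->
  all (fun i => all (fun j => (i == j) || has (fun m => E i m != E j m) (iota 0 n)) (iota 0 n)) (iota 0 n) ->
  contains S n E -> has_induced (SGraph rs ri) G.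
Proof.
move=> Esym rE /allP tf [xs [sz _ e]].
case: n => [|n] in r rs ri rE tf sz e *.
  by exists (fun i : 'I_0 => match notF (ltn_ord i) with end) => -[].
have x0 : G by case: (xs) sz.
have fE (x y : 'I_n.+1) : adj (nth x0 xs x) (nth x0 xs y) = r x y.
  rewrite rE; have lt (i j : 'I_n.+1) : i < j -> adj (nth x0 xs i) (nth x0 xs j) = E i j.
    move=> ij; rewrite (@pat_nth _ _ E (@adj G) 0 x0 (iota 0 n.+1)) ?size_iota ?ij ?ltn_ord //.
    by rewrite !nth_iota.
  case: (ltngtP x y) => [/lt //|yx|/val_inj ->]; last by rewrite adj_irr -rE ri.
  by rewrite adj_sym lt // Esym.
exists (fun i : 'I_n.+1 => nth x0 xs i) => // i j eij; apply/val_inj/eqP.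
have iI (m : 'I_n.+1) : val m \in iota 0 n.+1 by rewrite mem_iota /= ltn_ord.
(* Distinct vertices of the pattern have distinct neighborhoods, so their images cannot coincide. *)
have /allP/(_ _ (iI j))/orP[//|/hasP[m]] := tf _ (iI i).
rewrite mem_iota => /= mn; rewrite -!(rE _ (Ordinal mn)) -!fE /= eij eqxx //.
Qed.
End Patterns.

(** * Forbidden patterns and the finite checks *)

(* One ordering per orbit of possible first vertices. *)
Definition orders_H4 :=
  [:: [:: 5; 0; 1; 2; 3; 4]; [:: 4; 0; 5; 1; 2; 3];
      [:: 0; 5; 1; 4; 2; 3]; [:: 1; 5; 0; 4; 2; 3]].
Definition orders_W5 := [:: [:: 5; 0; 2; 4; 1; 3]; [:: 0; 5; 2; 3; 4; 1]].
Definition pats_base := [:: pat E_2K2 (iota 0 4)] ++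
  [:: pat E_K4 (iota 0 4)] ++ [seq pat E_H4 o | o <- orders_H4].
(* Rooted at its last vertex only: missed copies merely enlarge the search. *)
Definition pats_coico k := [seq pat coico o | o <- [seq i :: iota 0 i | i <- iota k (12 - k)]].
Definition pats_W5 := [seq pat coico o | o <- orders_W5].
Definition pats_odd := [:: pat (circ 5 2) [:: 0; 2; 4; 1; 3]] ++
  [:: pat (circ 7 2) [:: 0; 2; 4; 6; 1; 3; 5]].
Definition pats_prism := [:: pat (circ 6 2) [:: 0; 2; 4; 3; 5; 1]].
Definition pats_9 := [:: pat (circ 9 3) [:: 0; 3; 6; 4; 7; 1; 5; 8; 2]].

Definition bad_pat ps A := has_pat A (pats_base ++ ps).
(** For sets assumed 3-colorable: a part that is not 3-colorable is contradictory. *)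
Definition bad_col ps A := if has_pat A (pats_base ++ ps) then true else ~~ mat_colorable 3 A.

Definition check_search bad m E k :=
  let p := pat E (iota 0 k) in
  uniq (init_state bad p).1 && search bad (leaf_lowers_chi m) obl_irreducible 10 p.

Lemma check_coico : all (fun k => check_search (bad_pat (pats_coico k)) 4 coico k) (iota 6 7).
Proof. by vm_compute. Qed.

Lemma check_prism : check_search (bad_pat pats_odd) 3 (circ 6 2) 6.
Proof. by vm_compute. Qed.

(** The starting pattern is empty, so this search applies to every irreducible set. *)
Lemma check_noodd : check_search (bad_pat (pats_odd ++ pats_prism)) 3 (circ 6 2) 0.
Proof. by vm_compute. Qed.

Lemma check_9 : check_search (bad_col [::]) 3 (circ 9 3) 9.
Proof. by vm_compute. Qed.

Lemma check_C5 : check_search (bad_col pats_9) 3 (circ 5 2) 5.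
Proof. by vm_compute. Qed.

Lemma check_maxind : all (fun k => search (bad_pat pats_W5) (fun=> false) (obl_maxind k) 10
  (pat (circ k 2) (iota 0 k))) [:: 5; 7].
Proof. by vm_compute. Qed.

Lemma edge_rel_sym s : symmetric (edge_rel s).
Proof. by move=> i j; rewrite /edge_rel orbC. Qed.

Lemma E_K4_sym : symmetric E_K4.
Proof. by move=> i j; rewrite /E_K4 eq_sym. Qed.

Lemma circ_sym p q : symmetric (circ p q).
Proof. by move=> i j; rewrite /circ maxnC minnC. Qed.

Lemma coico_sym : symmetric coico.
Proof. by move=> i j; rewrite /coico eq_sym edge_rel_sym. Qed.

(** * Irreducible sets and mixing in the class *)

Section Class.
Variable G : sgraph.
Implicit Types (us : seq G) (S T : {set G}).
Hypotheses (no_2K2 : induced_free two_K2 G) (no_K4 : induced_free K4 G)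
  (no_H4 : induced_free H4 G).

Lemma base_free S us : all (mem S) us -> has_pat (mat us) pats_base = false.
Proof.
move=> usS; apply/negP; rewrite !has_pat_cat => /or3P[].
- move/(has_pat1 (@edge_rel_sym _) usS)/(_ isT) => c; apply: no_2K2.
  apply: contains_induced c => //; first exact: edge_rel_sym.
  by case=> [[|[|[|[|//]]]] i] [[|[|[|[|//]]]] j].
- move/(has_pat1 E_K4_sym usS)/(_ isT) => c; apply: no_K4.
  by apply: contains_induced c => //; apply: E_K4_sym.
- case/(@has_pat_contains _ _ _ orders_H4 _ (@edge_rel_sym _) isT usS) => o oo.
  have -> : size o = 6 by move: oo; rewrite !inE => /or4P[] /eqP->.
  move=> c; apply: no_H4; apply: contains_induced c => //; first exact: edge_rel_sym.
  by case=> [[|[|[|[|[|[|//]]]]]] i] [[|[|[|[|[|[|//]]]]]] j].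
Qed.

Lemma search_lowers_chi S m (bad : seq (seq bool) -> bool) E k : irreducible S ->
  (forall us, all (mem S) us -> bad (mat us) -> colorable_on S m /\ T_lowers_chi S) ->
  check_search bad m E k -> contains S k E -> colorable_on S m /\ T_lowers_chi S.
Proof.
move=> irr badS /andP[urows gr].
by apply: (search_irreducible badS irr _ urows gr) => vs uvs Svs; apply: leaf_lowers_chi_sound.
Qed.

(** Downward induction on [k]: a copy of a longer prefix of [coico] is settled by induction, so the
    search from the prefix of length [k] may treat it as bad. *)
Lemma coico_lowers_chi S k : irreducible S -> 6 <= k <= 12 -> contains S k coico ->
  colorable_on S 4 /\ T_lowers_chi S.
Proof.
move=> irr; have [d] := ubnP (12 - k); elim: d k => // d IH k dk /andP[k6 k12].
apply: (@search_lowers_chi S 4 (bad_pat (pats_coico k))) => //; last first.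
  by apply: (allP check_coico); rewrite mem_iota k6.
move=> us usS; rewrite /bad_pat has_pat_cat (base_free usS) /=.
case/(has_pat_contains coico_sym _ usS) => [|_ /mapP[i ik ->]].
  apply/allP => _ /mapP[i _ ->].
  have -> : size (i :: iota 0 i) = i + 1 by rewrite /= size_iota addn1.
  by rewrite iotaD -cat1s perm_catC.
move: ik; rewrite mem_iota subnKC // => /andP[ki i12].
rewrite /= size_iota; apply: IH; last by rewrite i12 (leq_trans k6) // ltnW.
rewrite -ltnS; apply: leq_trans dk; rewrite ltnS; apply: ltn_sub2l => //.
exact: leq_trans ki i12.
Qed.

Lemma bad_pat_sound S us ps : all (mem S) us -> bad_pat ps (mat us) -> has_pat (mat us) ps.
Proof. by move=> usS; rewrite /bad_pat has_pat_cat (base_free usS). Qed.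

(** The prism case is settled first, so that the search from the empty graph can exclude it. *)
Lemma noodd_lowers_chi S : irreducible S -> ~ contains S 5 (circ 5 2) ->
  ~ contains S 7 (circ 7 2) -> colorable_on S 3 /\ T_lowers_chi S.
Proof.
move=> irr no5 no7.
have nodd us : all (mem S) us -> has_pat (mat us) pats_odd = false.
  move=> usS; apply/negP; rewrite /pats_odd has_pat_cat => /orP[].
    by move/(has_pat1 (@circ_sym _ _) usS)/(_ isT).
  by move/(has_pat1 (@circ_sym _ _) usS)/(_ isT).
have prism : contains S 6 (circ 6 2) -> colorable_on S 3 /\ T_lowers_chi S.
  apply: (search_lowers_chi irr _ check_prism) => us usS /(bad_pat_sound usS).
  by rewrite nodd.
apply: (search_lowers_chi irr _ check_noodd) => [us usS /(bad_pat_sound usS)|]; last by exists [::].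
rewrite has_pat_cat nodd // orFb.
by move/(has_pat1 (@circ_sym _ _) usS)/(_ isT).
Qed.

Lemma bad_col_sound S us ps : colorable_on S 3 -> all (mem S) us ->
  bad_col ps (mat us) -> has_pat (mat us) ps.
Proof.
move=> cS usS; rewrite /bad_col has_pat_cat (base_free usS) /=; case: ifP => // _.
rewrite mat_colorable_complete //; apply: colorable_onW cS => // x; exact: (allP usS).
Qed.

Lemma C5_lowers_chi S : irreducible S -> colorable_on S 3 -> contains S 5 (circ 5 2) ->
  T_lowers_chi S.
Proof.
move=> irr cS c5.
have c9 : contains S 9 (circ 9 3) -> colorable_on S 3 /\ T_lowers_chi S.
  by apply: (search_lowers_chi irr _ check_9) => us usS /(bad_col_sound cS usS).
suff [] : colorable_on S 3 /\ T_lowers_chi S by [].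
apply: (search_lowers_chi irr _ check_C5 c5) => us usS /(bad_col_sound cS usS).
by move/(has_pat1 (@circ_sym _ _) usS)/(_ isT).
Qed.

(** If the copy avoided [T], each of its vertices would have a neighbor in [T], and the search finds
    that this forces a W5. *)
Lemma maxind_hits S T k : maxind S T -> ~ contains S 6 coico -> k \in [:: 5; 7] ->
  ~ contains (S :\: T) k (circ k 2).
Proof.
move=> mT noW k57; apply: (search_maxind (bad := bad_pat pats_W5) _ mT (allP check_maxind k k57)).
move=> us usS /(bad_pat_sound usS) /(@has_pat_contains _ _ _ orders_W5 _ coico_sym isT usS)[o oo].
by have -> : size o = 6 by move: oo; rewrite !inE => /orP[] /eqP->.
Qed.

Lemma irreducibleP S : irreducible S \/ exists u v,
  [/\ u \in S, v \in S, u != v & {in S, forall w, adj u w -> adj v w}].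
Proof.
case: (boolP [exists u in S, [exists v in S, (u != v) && [forall w in S, adj u w ==> adj v w]]]).
  case/exists_inP=> u uS /exists_inP[v vS /andP[nuv /forall_inP h]].
  by right; exists u, v; split=> // w wS; apply/implyP/h.
move/exists_inPn => h; left=> u v uS vS nuv.
have /exists_inPn/(_ v vS) := h u uS; rewrite nuv /= => /forall_inPn[w wS].
by rewrite negb_imply => /andP[uw vw]; exists w.
Qed.

(** Deleting dominated vertices leads to an irreducible set; each deleted vertex can reuse the color
    of the one dominating it. *)
Lemma colorable3 S : ~ contains S 5 (circ 5 2) -> ~ contains S 7 (circ 7 2) ->
  colorable_on S 3.
Proof.
have [n] := ubnP #|S|; elim: n S => // n IH S Sn no5 no7.
case: (irreducibleP S) => [irr|[u [v [uS vS nuv sub]]]].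
  by case: (noodd_lowers_chi irr no5 no7).
have sS : S :\ u \subset S by apply: subD1set.
have [|||f [fk fp]] := IH (S :\ u); first by rewrite (cardsD1 u) uS in Sn.
- by move/(contains_sub sS).
- by move/(contains_sub sS).
have vSu : v \in S :\ u by rewrite !inE eq_sym nuv.
have inSu x : x \in S -> x != u -> x \in S :\ u by rewrite !inE => -> ->.
exists (fun x => if x == u then f v else f x); split=> [x xS|x y xS yS].
  by have [_|nx] := eqVneq x u; apply: fk => //; apply: inSu.
have [->|nx] := eqVneq x u; have [->|ny] := eqVneq y u.
- by rewrite adj_irr.
- by move/(sub y yS); apply: fp => //; apply: inSu.
- by rewrite adj_sym => /(sub x xS); rewrite adj_sym; apply: fp => //; apply: inSu.
- by apply: fp; apply: inSu.
Qed.

Lemma irreducible_lowers_chi S : irreducible S -> T_lowers_chi S.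
Proof.
move=> irr.
case: (containsP S 6 coico) => [W|noW].
  by case: (coico_lowers_chi (k := 6) irr isT W).
move=> k T cS mT.
have [k3|k3] := leqP k 3.
  have cS3 : colorable_on S 3 by apply: colorable_onW cS.
  suff gS : T_lowers_chi S by apply: gS.
  case: (containsP S 5 (circ 5 2)) => [|no5]; first exact: C5_lowers_chi.
  (* The complement of C7 is not 3-colorable. *)
  by case: (noodd_lowers_chi irr no5) => // c7; apply: contains_not_colorable c7 cS3.
(* Here [k] is at least 4, so 3 colors on [S :\: T] suffice; [T] meets every C5 and every complement
   of C7. *)
apply: (@colorable_onW _ _ (mem (S :\: T)) 3) => //; first by rewrite -ltnS prednK // ltnW // ltnW // ltnW.
by apply: colorable3; apply: maxind_hits.
Qed.

Lemma class_in_maxind S (A : {set G}) : A \subset S -> {in A &, forall x y, ~~ adj x y} ->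
  exists2 T : {set G}, A \subset T & maxind S T.
Proof.
move=> AS indA.
pose I (T : {set G}) := (T \subset S) && [forall x in T, forall y in T, ~~ adj x y].
have IA : I A.
  by rewrite /I AS; apply/forall_inP => x xA; apply/forall_inP => y; apply: indA.
have [T /maxsetP[/andP[TS /forall_inP indT] maxT] AT] := maxset_exists IA.
have ind : {in T &, forall x y, ~~ adj x y} by move=> x y /indT /forall_inP; apply.
exists T => //; split=> // x xS xT.
case: (boolP [exists y in T, adj x y]) => [/exists_inP//|/exists_inPn nx].
case/negP: xT; rewrite -(maxT (x |: T)) ?setU11 ?subsetUr //.
rewrite /I subUset sub1set xS TS /=; apply/forall_inP => y yT; apply/forall_inP => z.
move: yT; rewrite !inE => /predU1P[->|yT] /predU1P[->|zT]; rewrite ?adj_irr //.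
- exact: nx.
- by rewrite adj_sym nx.
- exact: ind.
Qed.

(** The outer induction on [k] handles [S :\: T], the inner one on the size of [S] the deletion of a
    dominated vertex. *)
Lemma mixing_colorable S k : colorable_on S k -> mixing S k.+1.
Proof.
elim: k S => [|k IHk] S.
  move=> [h [h0 _]] P f g _ _ _ _; apply: reach_eq => x /h0; by rewrite ltn0.
have [n] := ubnP #|S|; elim: n S => // n IH S Sn cS.
case: (irreducibleP S) => [irr|[u [v [uS vS nuv sub]]]]; last first.
  apply: (mixing_comparable uS vS nuv sub); apply: IH.
    by rewrite (cardsD1 u) uS in Sn.
  by apply: colorable_onW cS => // x /setD1P[].
apply: mixing_step => [P f uP sP [fP fp]|T]; last exact: IHk.
(* Any color would do; the palette has [k.+2] colors, so its first one exists. *)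
have cP : nth 0 P 0 \in P by apply: mem_nth; rewrite sP.
set c := nth 0 P 0 in cP; pose A := [set x in S | f x == c].
have [||T AT mT] := @class_in_maxind S A; first by apply/subsetP => x; rewrite inE => /andP[].
  move=> x y; rewrite !inE => /andP[xS /eqP fx] /andP[yS /eqP fy].
  by apply/negP => /(fp _ _ xS yS); rewrite fx fy eqxx.
have [TS indT _] := mT; exists c, T; split=> //.
  by move=> x xS fx; apply: (subsetP AT); rewrite inE xS fx eqxx.
exact: (irreducible_lowers_chi irr cS mT).
Qed.

End Class.

(** * Transfer to the reconfiguration graph *)

Section Connected.
Variables (G : sgraph) (l : nat).

Lemma reach_connect (c d : reconf_graph G l) (f g : G -> nat) :
  (forall x, f x = val c x) -> (forall x, g x = val d x) ->
  reach setT (iota 0 l) f g -> connect (@adj (reconf_graph G l)) c d.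
Proof.
move=> fc gd R; elim: R c d fc gd => {f g} [f g fg|f g v a vS [fP fp] R IH] c d fc gd.
  suff -> : c = d by apply: connect0.
  apply/val_inj/ffunP => x; apply/val_inj.
  by have := fg x; rewrite inE fc gd; apply.
have lt x : recolor f v a x < l by have := fP x; rewrite inE mem_iota; apply.
pose e0 : {ffun G -> 'I_l} := [ffun x => Ordinal (lt x)].
have pe : Defs.proper e0.
  apply/forallP => x; apply/forallP => y; apply/implyP => xy; rewrite !ffunE.
  by apply: fp; rewrite ?inE.
pose e : reconf_graph G l := exist _ e0 pe.
have ee x : recolor f v a x = val e x by rewrite /= ffunE.
apply: connect_trans (IH e d ee gd).
(* A step of [reach] may leave the color unchanged and then corresponds to no edge. *)
have [->|nce] := eqVneq c e; first exact: connect0.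
apply: connect1; rewrite /= /recolor_rel; apply/cards1P; exists v.
have cv x : x != v -> val c x = val e x.
  by move=> xv; apply/val_inj; rewrite /= -ee -fc /recolor (negPf xv).
apply/setP => x; rewrite !inE; have [->|xv] := eqVneq x v; last by rewrite cv ?eqxx.
apply: contraNneq nce => ecv; apply/eqP/val_inj/ffunP => y.
by have [->|] := eqVneq y v; last exact: cv.
Qed.
End Connected.

Theorem mainTheorem2 (G : sgraph) :
  induced_free two_K2 G -> induced_free K4 G -> induced_free H4 G ->
  recolorable G.
Proof.
move=> n2 n4 nH [|k] // chik c d.
have proper_col l (a : {ffun G -> 'I_l}) : Defs.proper a ->
    {in [set: G] &, forall x y, adj x y -> val (a x) != val (a y)}.
  by move=> pa x y _ _ xy; have /forallP/(_ x)/forallP/(_ y)/implyP := pa; apply.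
have col : colorable_on [set: G] k.
  move: chik; rewrite /chi; case: ex_minnP => m /existsP[a pa] _ mk.
  exists (fun x => val (a x)); split=> [x _|]; last exact: proper_col.
  exact: (leq_trans (ltn_ord (a x)) mk).
have pon (a : reconf_graph G k.+1) : proper_on setT (iota 0 k.+1) (fun x => val (val a x)).
  split=> [x _|]; first by rewrite mem_iota /= ltn_ord.
  exact: proper_col (valP a).
apply: reach_connect (fun x => erefl) (fun x => erefl) _.
apply: (mixing_colorable n2 n4 nH col); rewrite ?iota_uniq ?size_iota //; exact: pon.
Qed.
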